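(* $\mathsf{RCA}_0$ does not prove the statement: every partial order all of whose initial intervals are finite unions of ideals has no infinite antichains.
   Context: A partial order $(P,\preceq)$ has $P\subseteq\mathbb{N}$. An antichain is a set of pairwise incomparable elements. An initial interval of $P$ is $I\subseteq P$ with $x\preceq y\in I\Rightarrow x\in I$. An ideal is an initial interval $A$ such that for all $x,y\in A$ there is $z\in A$ with $x\preceq z$ and $y\preceq z$. *)

(* Defs.v *)
(* The language L_2 of second-order arithmetic, a classical
   two-sorted natural deduction calculus with equality, the theory RCA_0, and
   the formal sentence about partial orders.
   Variables are de Bruijn indices; number variables and set variables are
   indexed independently, so a number quantifier does not shift set variables,
   nor a set quantifier number variables. *)
From Stdlib Require Import List Arith.
Import ListNotations.

Inductive term : Type :=
| Var  : nat -> term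
| Zero : term
| One  : term
| TAdd : term -> term -> term
| TMul : term -> term -> term.

Inductive form : Type :=
| Eq   : term -> term -> form
| Lt   : term -> term -> form
| Mem  : term -> nat -> form       (* the second argument is a set variable *)
| Bot  : form
| Imp  : form -> form -> form
| And  : form -> form -> form
| Or   : form -> form -> form
| NAll : form -> form
| NEx  : form -> form
| SAll : form -> form
| SEx  : form -> form.

Declare Scope L2_scope.
Delimit Scope L2_scope with L2.
Bind Scope L2_scope with term form.

Notation "# n" := (Var n) (at level 1, format "# n") : L2_scope.
Notation "s + t" := (TAdd s t) : L2_scope.
Notation "s * t" := (TMul s t) : L2_scope.
Notation "s == t" := (Eq s t) (at level 70) : L2_scope.
Notation "s < t" := (Lt s t) : L2_scope.
Notation "t 'IN' X" := (Mem t X) (at level 70, X at level 9) : L2_scope.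
Notation "a --> b" := (Imp a b) (at level 90, right associativity) : L2_scope.
Notation "a /\ b" := (And a b) : L2_scope.
Notation "a \/ b" := (Or a b) : L2_scope.
Notation "a <--> b" := (And (Imp a b) (Imp b a)) (at level 91) : L2_scope.
Notation "~ a" := (Imp a Bot) : L2_scope.

Fixpoint tsubst (s : nat -> term) (t : term) : term :=
  match t with
  | Var n => s n
  | Zero => Zero
  | One => One
  | TAdd a b => TAdd (tsubst s a) (tsubst s b)
  | TMul a b => TMul (tsubst s a) (tsubst s b)
  end.

Definition tshift : term -> term := tsubst (fun n => Var (S n)).

Definition scons {A : Type} (a : A) (f : nat -> A) (n : nat) : A :=
  match n with 0 => a | S m => f m end.

Definition nup (s : nat -> term) : nat -> term :=
  scons (Var 0) (fun n => tshift (s n)).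

Definition sup (r : nat -> nat) : nat -> nat :=
  scons 0 (fun n => S (r n)).

Fixpoint fsubst (s : nat -> term) (r : nat -> nat) (f : form) : form :=
  match f with
  | Eq a b => Eq (tsubst s a) (tsubst s b)
  | Lt a b => Lt (tsubst s a) (tsubst s b)
  | Mem a X => Mem (tsubst s a) (r X)
  | Bot => Bot
  | Imp f g => Imp (fsubst s r f) (fsubst s r g)
  | And f g => And (fsubst s r f) (fsubst s r g)
  | Or f g => Or (fsubst s r f) (fsubst s r g)
  | NAll f => NAll (fsubst (nup s) r f)
  | NEx f => NEx (fsubst (nup s) r f)
  | SAll f => SAll (fsubst s (sup r) f)
  | SEx f => SEx (fsubst s (sup r) f)
  end.

Definition ninst (t : term) : form -> form := fsubst (scons t Var) (fun X => X).
Definition sinst (X : nat) : form -> form := fsubst Var (scons X (fun Y => Y)).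
Definition nshift : form -> form := fsubst (fun n => Var (S n)) (fun X => X).
Definition sshift : form -> form := fsubst Var S.

Inductive prv : list form -> form -> Prop :=
| P_Hyp   G f : In f G -> prv G f
| P_ImpI  G f g : prv (f :: G) g -> prv G (Imp f g)
| P_ImpE  G f g : prv G (Imp f g) -> prv G f -> prv G g
| P_AndI  G f g : prv G f -> prv G g -> prv G (And f g)
| P_AndE1 G f g : prv G (And f g) -> prv G f
| P_AndE2 G f g : prv G (And f g) -> prv G g
| P_OrI1  G f g : prv G f -> prv G (Or f g)
| P_OrI2  G f g : prv G g -> prv G (Or f g)
| P_OrE   G f g h :
    prv G (Or f g) -> prv (f :: G) h -> prv (g :: G) h -> prv G h
| P_Raa   G f : prv (Imp f Bot :: G) Bot -> prv G f
| P_NAllI G f : prv (map nshift G) f -> prv G (NAll f)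
| P_NAllE G f t : prv G (NAll f) -> prv G (ninst t f)
| P_NExI  G f t : prv G (ninst t f) -> prv G (NEx f)
| P_NExE  G f g :
    prv G (NEx f) -> prv (f :: map nshift G) (nshift g) -> prv G g
| P_SAllI G f : prv (map sshift G) f -> prv G (SAll f)
| P_SAllE G f X : prv G (SAll f) -> prv G (sinst X f)
| P_SExI  G f X : prv G (sinst X f) -> prv G (SEx f)
| P_SExE  G f g :
    prv G (SEx f) -> prv (f :: map sshift G) (sshift g) -> prv G g
| P_EqI   G t : prv G (Eq t t)
| P_EqE   G s t f : prv G (Eq s t) -> prv G (ninst s f) -> prv G (ninst t f).

Definition proves (T : form -> Prop) (f : form) : Prop :=
  exists G : list form, (forall a, In a G -> T a) /\ prv G f.

Fixpoint tbound (t : term) : nat :=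
  match t with
  | Var n => S n
  | Zero | One => 0
  | TAdd a b | TMul a b => Nat.max (tbound a) (tbound b)
  end.

(* [nbound f] and [sbound f] are the least n such that every free number
   (resp. set) variable of f is < n. *)
Fixpoint nbound (f : form) : nat :=
  match f with
  | Eq a b | Lt a b => Nat.max (tbound a) (tbound b)
  | Mem a _ => tbound a
  | Bot => 0
  | Imp f g | And f g | Or f g => Nat.max (nbound f) (nbound g)
  | NAll f | NEx f => Nat.pred (nbound f)
  | SAll f | SEx f => nbound f
  end.

Fixpoint sbound (f : form) : nat :=
  match f with
  | Eq _ _ | Lt _ _ | Bot => 0
  | Mem _ X => S X
  | Imp f g | And f g | Or f g => Nat.max (sbound f) (sbound g)
  | NAll f | NEx f => sbound f
  | SAll f | SEx f => Nat.pred (sbound f)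
  end.

Definition closure (f : form) : form :=
  Nat.iter (sbound f) SAll (Nat.iter (nbound f) NAll f).

(* [tshift t]: the bound of a bounded quantifier does not contain the
   quantified variable.  Set variables may occur as parameters. *)
Definition ball (t : term) (f : form) : form := NAll (Imp (Lt (Var 0) (tshift t)) f).
Definition bex (t : term) (f : form) : form := NEx (And (Lt (Var 0) (tshift t)) f).

Inductive bounded : form -> Prop :=
| B_Eq s t : bounded (Eq s t)
| B_Lt s t : bounded (Lt s t)
| B_Mem t X : bounded (Mem t X)
| B_Bot : bounded Bot
| B_Imp f g : bounded f -> bounded g -> bounded (Imp f g)
| B_And f g : bounded f -> bounded g -> bounded (And f g)
| B_Or f g : bounded f -> bounded g -> bounded (Or f g)
| B_All t f : bounded f -> bounded (ball t f)
| B_Ex t f : bounded f -> bounded (bex t f).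

Inductive Sigma01 : form -> Prop :=
| Sigma01_intro f : bounded f -> Sigma01 (NEx f).

Inductive Pi01 : form -> Prop :=
| Pi01_intro f : bounded f -> Pi01 (NAll f).

(* Here #1 is m and #0 is n. *)
Definition basic_axioms : list form :=
  [ ~ (#0 + One == Zero);
    #1 + One == #0 + One --> #1 == #0;
    #1 + Zero == #1;
    #1 + (#0 + One) == (#1 + #0) + One;
    #1 * Zero == Zero;
    #1 * (#0 + One) == (#1 * #0) + #1;
    ~ (#1 < Zero);
    #1 < #0 + One <--> (#1 < #0 \/ #1 == #0) ]%L2.

(* The induction variable is #0. *)
Definition induction (f : form) : form :=
  (ninst Zero f
   /\ NAll (f --> fsubst (scons (#0 + One) (fun n => #(S n))) (fun X => X) f)
   --> NAll f)%L2.

(* The comprehension variable is #0; [sshift] keeps the new set out of f. *)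
Definition delta_comprehension (f g : form) : form :=
  (NAll (f <--> g) --> SEx (NAll (#0 IN 0 <--> sshift f)))%L2.

Inductive RCA0 : form -> Prop :=
| RCA0_basic_ax f : In f basic_axioms -> RCA0 (closure f)
| RCA0_ind_ax f : Sigma01 f -> RCA0 (closure (induction f))
| RCA0_comp_ax f g :
    Sigma01 f -> Pi01 g -> RCA0 (closure (delta_comprehension f g)).

(* The usual pairing of second-order arithmetic, (i,j) = (i+j)^2 + i. *)
Definition code (i j : term) : term := ((i + j) * (i + j) + i)%L2.

(* The arguments P, R, I, A, D, Z below are set variables; R is the set of
   codes of the pairs (x,y) such that x precedes y. *)
Definition below (R : nat) (x y : term) : form := (code x y IN R)%L2.

Definition subset (X Y : nat) : form := NAll (#0 IN X --> #0 IN Y)%L2.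

Definition partial_order (P R : nat) : form :=
  (NAll (#0 IN R --> NEx (NEx (#1 IN P /\ #0 IN P /\ #2 == code #1 #0)))
   /\ NAll (#0 IN P --> below R #0 #0)
   /\ NAll (NAll (below R #1 #0 --> below R #0 #1 --> #1 == #0))
   /\ NAll (NAll (NAll (below R #2 #1 --> below R #1 #0 --> below R #2 #0))))%L2.

Definition initial_interval (P R I : nat) : form :=
  (subset I P
   /\ NAll (NAll (below R #1 #0 --> #0 IN I --> #1 IN I)))%L2.

Definition ideal (P R A : nat) : form :=
  (initial_interval P R A
   /\ NAll (NAll (#1 IN A --> #0 IN A -->
        NEx (#0 IN A /\ below R #2 #0 /\ below R #1 #0))))%L2.

(* A = (Z)_i, the i-th set of the sequence of sets coded by Z. *)
Definition is_section (Z : nat) (i : term) (A : nat) : form :=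
  NAll (#0 IN A <--> code #0 (tshift i) IN Z)%L2.

(* There are k and Z such that (Z)_0, ..., (Z)_(k-1) are ideals with union I. *)
Definition finite_union_of_ideals (P R I : nat) : form :=
  NEx (SEx
    (ball #0 (SEx (is_section 1 #0 0 /\ ideal (S (S P)) (S (S R)) 0))
     /\ NAll (#0 IN (S I) <--> bex #1 (code #1 #0 IN 0))))%L2.

Definition infinite (D : nat) : form := NAll (NEx (#1 < #0 /\ #0 IN D))%L2.

Definition antichain (P R D : nat) : form :=
  (subset D P
   /\ NAll (NAll (#1 IN D --> #0 IN D --> ~ (#1 == #0) -->
        ~ (below R #1 #0) /\ ~ (below R #0 #1))))%L2.

(* The set variables P and R are 1 and 0, and 2 and 1 below a further set
   quantifier. *)
Definition finite_unions_imply_no_infinite_antichain : form :=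
  SAll (SAll
    (partial_order 1 0
     /\ SAll (initial_interval 2 1 0 --> finite_union_of_ideals 2 1 0)
     --> ~ SEx (antichain 2 1 0 /\ infinite 0)))%L2.

(* Main.v *)
From Stdlib Require Import List Arith Lia Cantor Relations.
From Stdlib Require Import Classical ClassicalEpsilon FunctionalExtensionality.
Require Import Defs.

(* We build an order R on nat in which the even numbers are an antichain, such
   that the omega-model of all sets Delta_1 in R refutes the sentence.  R is
   obtained by forcing.  A condition is an order with a level n such that all
   elements z >= n have the same type over [0,n).  Given Sigma_1 definitions of
   a set I and of its complement, look at the element n.  If some extension
   leaving n incomparable with n+1, n+2, ... puts n into I, take a finite part
   of it that secures this and put n above all later elements; if some such
   extension puts n outside I, put n below all later elements; otherwise leave
   n alone, and then neither definition ever applies to n.  Hence an initial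
   interval in the model either contains an element above almost all others or
   is finite, so it is a finite union of principal ideals. *)

(** * Finite approximations of orders *)

Definition agree (n : nat) (R T : relation nat) : Prop :=
  forall a b, a < n -> b < n -> (R a b <-> T a b).

Lemma agree_trans n R S T : agree n R S -> agree n S T -> agree n R T.
Proof. intros H K a b Ha Hb. rewrite (H a b Ha Hb). exact (K a b Ha Hb). Qed.

Lemma agree_le m n R T : m <= n -> agree n R T -> agree m R T.
Proof. intros L H a b Ha Hb. apply H; lia. Qed.

Definition uniform_above (n : nat) (R : relation nat) : Prop :=
  forall a z, a < n -> n <= z -> (R a z <-> R a n) /\ (R z a <-> R n a).

Lemma uniform_above_transfer n m R T :
  n <= m -> uniform_above n R -> agree (S m) R T -> uniform_above m T ->
  uniform_above n T.
Proof.
  intros L UR A UT a z Ha Hz.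
  rewrite <- (A a n), <- (A n a) by lia.
  destruct (le_lt_dec z m) as [Lz|Lz].
  - rewrite <- (A a z), <- (A z a) by lia. apply UR; lia.
  - destruct (UT a z) as [-> ->]; try lia.
    rewrite <- (A a m), <- (A m a) by lia. apply UR; lia.
Qed.

Definition incomparable (R : relation nat) (a b : nat) : Prop := ~ R a b /\ ~ R b a.

(* The elements from [m] on become pairwise incomparable, above [L] and below
   [U]; what [R] says about them is forgotten. *)
Definition fill_gap (m : nat) (R : relation nat) (L U : nat -> Prop) : relation nat :=
  fun x y =>
    match x <? m, y <? m with
    | true, true => R x y
    | true, false => L x
    | false, true => U y
    | false, false => x = y
    end.

Record gap (R : relation nat) (L U : nat -> Prop) : Prop := {
  gap_lower a b : R a b -> L b -> L a;
  gap_upper a b : R a b -> U a -> U b;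
  gap_below a b : L a -> U b -> R a b;
  gap_disjoint a : L a -> ~ U a }.

Ltac split_fill_gap m := unfold fill_gap in *;
  repeat match goal with
  | H : context [?x <? m] |- _ => destruct (Nat.ltb_spec x m); try lia
  | |- context [?x <? m] => destruct (Nat.ltb_spec x m); try lia
  end.

Lemma fill_gap_order m R L U : order nat R -> gap R L U -> order nat (fill_gap m R L U).
Proof.
  intros [r t a] [l u b d]; split.
  - intros x. split_fill_gap m; auto.
  - intros x y z Hxy Hyz. split_fill_gap m; subst; eauto.
    destruct (d y); assumption.
  - intros x y Hxy Hyx. split_fill_gap m; auto; [destruct (d y)|destruct (d x)];
      assumption.
Qed.

Lemma fill_gap_agree m R L U : agree m R (fill_gap m R L U).
Proof. intros a b Ha Hb. split_fill_gap m. reflexivity. Qed.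

Lemma fill_gap_uniform m c R L U : m <= c -> uniform_above c (fill_gap m R L U).
Proof. intros Hc a z Ha Hz. split_fill_gap m; split; split; auto; lia. Qed.

Lemma fill_gap_uniform_below n m R L U :
  n < m -> uniform_above n R ->
  (forall a, a < n -> (L a <-> R a n) /\ (U a <-> R n a)) ->
  uniform_above n (fill_gap m R L U).
Proof. intros Hn UR LU a z Ha Hz. split_fill_gap m; auto. Qed.

(* [n] is below the elements from [m] on iff [P], and above them iff [Q]; the
   elements other than [n] are related to them as they are to [n]. *)
Definition place (n m : nat) (R : relation nat) (P Q : Prop) : relation nat :=
  fill_gap m R (fun a => R a n /\ (a = n -> P)) (fun b => R n b /\ (b = n -> Q)).

Lemma place_spec n m R P Q z :
  reflexive nat R -> n < m -> m <= z ->
  (place n m R P Q n z <-> P) /\ (place n m R P Q z n <-> Q).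
Proof. intros r Hn Hz. unfold place. split_fill_gap m. split; split; intuition. Qed.

Lemma place_order n m R P Q : order nat R -> ~ (P /\ Q) -> order nat (place n m R P Q).
Proof.
  intros G PQ. apply fill_gap_order; [exact G|].
  destruct G as [r t a]; split.
  - intros x y Hxy [Hy HP]. split; [eauto|]. intros ->. apply HP, a; assumption.
  - intros x y Hxy [Hx HQ]. split; [eauto|]. intros ->. apply HQ, a; assumption.
  - intros x y [Hx _] [Hy _]. eauto.
  - intros x [Hx HP] [Hx' HQ]. assert (x = n) by auto. tauto.
Qed.

Lemma place_uniform_below n m R P Q :
  n < m -> uniform_above n R -> uniform_above n (place n m R P Q).
Proof.
  intros Hn UR. apply fill_gap_uniform_below; [assumption|assumption|].
  intros a Ha. split; (split; [tauto|]); intros H; (split; [exact H|lia]).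
Qed.

(** * A generic order *)

Definition open_pred (X : relation nat -> Prop) : Prop :=
  forall R, X R -> exists m, forall T, agree m R T -> X T.

Definition unbounded (D : nat -> Prop) : Prop := forall n, exists m, n <= m /\ D m.

Section Forcing.

Variable D : nat -> Prop.
Hypothesis D_unbounded : unbounded D.
Hypothesis D_co_unbounded : unbounded (fun n => ~ D n).

Record antichain_order (R : relation nat) : Prop := {
  antichain_order_order :> order nat R;
  antichain_eq a b : D a -> D b -> R a b -> a = b }.

Lemma uniform_above_incomparable R n a :
  antichain_order R -> uniform_above n R -> a < n -> D a -> incomparable R a n.
Proof.
  intros G UR Ha Da. destruct (D_unbounded n) as (z & Hz & Dz).
  destruct (UR a z Ha Hz) as [E E'].
  split; intros H; [apply E in H|apply E' in H];
    apply (antichain_eq R G) in H; (assumption || lia).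
Qed.

Lemma place_antichain_order n m R P Q :
  antichain_order R -> uniform_above n R -> ~ D n ->
  (forall z, n < z -> z < m -> incomparable R n z) -> ~ (P /\ Q) ->
  antichain_order (place n m R P Q).
Proof.
  intros G UR Dn Inc PQ. split; [apply place_order; [apply G|exact PQ]|].
  assert (Din : forall a, a < m -> D a -> incomparable R a n).
  { intros a Ha Da. destruct (Nat.lt_trichotomy a n) as [L|[->|L]].
    - apply uniform_above_incomparable; assumption.
    - contradiction.
    - destruct (Inc a L Ha). split; assumption. }
  intros a b Da Db. unfold place. split_fill_gap m.
  - apply (antichain_eq R G); assumption.
  - intros [Han _]. destruct (Din a) as [[] _]; assumption.
  - intros [Hnb _]. destruct (Din b) as [_ []]; assumption.
Qed.

(* A condition describes an order on [0,level] and promises that all elements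
   from [level] on have the same type over [0,level). *)
Record condition : Type := Condition {
  level : nat;
  approx : relation nat;
  level_notin : ~ D level;
  approx_antichain_order : antichain_order approx;
  approx_uniform : uniform_above level approx }.

Lemma condition_inhabited : inhabited condition.
Proof.
  destruct (D_co_unbounded 0) as (n & _ & Dn).
  assert (G : antichain_order eq).
  { split; [split|]; [intros x|intros x y z| |]; congruence. }
  assert (U : uniform_above n eq) by (intros a z; lia).
  exact (inhabits (Condition n eq Dn G U)).
Qed.

Definition extends (p : condition) (R : relation nat) : Prop :=
  agree (S (level p)) (approx p) R /\ uniform_above (level p) R.

Definition refines (p q : condition) : Prop :=
  level p < level q /\ extends p (approx q).

Definition forces (q : condition) (X : relation nat -> Prop) : Prop :=
  forall R, antichain_order R -> extends q R -> X R.

Lemma extends_approx p : extends p (approx p).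
Proof. split; [intros a b _ _; reflexivity|apply approx_uniform]. Qed.

Lemma extends_trans p q R :
  level p <= level q -> extends p (approx q) -> extends q R -> extends p R.
Proof.
  intros L [A U] [A' U']. split.
  - apply (agree_trans _ _ (approx q)); [exact A|].
    apply (agree_le _ (S (level q))); [lia|exact A'].
  - apply (uniform_above_transfer _ (level q) (approx q)); assumption.
Qed.

Lemma extends_min q R a z :
  extends q R -> a < level q ->
  (R a z <-> approx q a (min z (level q))) /\ (R z a <-> approx q (min z (level q)) a).
Proof.
  intros [A U] Ha. rewrite (A a), (A _ a) by lia.
  destruct (le_lt_dec z (level q)) as [L|L].
  - rewrite Nat.min_l by exact L. tauto.
  - rewrite Nat.min_r by lia. apply U; lia.
Qed.

Lemma refine_placing p R m P Q :
  antichain_order R -> extends p R -> level p < m ->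
  (forall z, level p < z -> z < m -> incomparable R (level p) z) -> ~ (P /\ Q) ->
  exists q, refines p q /\
    forces q (fun T => agree m R T /\
      forall z, m <= z -> (T (level p) z <-> P) /\ (T z (level p) <-> Q)).
Proof.
  set (n := level p). intros G [A U] Hm Inc PQ.
  destruct (D_co_unbounded m) as (c & Hc & Dc).
  assert (G' : antichain_order (place n m R P Q))
    by (apply place_antichain_order; auto; apply level_notin).
  assert (U' : uniform_above c (place n m R P Q)) by (apply fill_gap_uniform, Hc).
  exists (Condition c _ Dc G' U'). split; [split; [|split]|]; simpl.
  - fold n. lia.
  - apply (agree_trans _ _ R); [exact A|].
    apply (agree_le _ m); [exact Hm|apply fill_gap_agree].
  - apply place_uniform_below; assumption.
  - intros T _ E. split.
    + apply (agree_trans _ _ (place n m R P Q)); [apply fill_gap_agree|].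
      apply (agree_le _ (S c)); [lia|apply E].
    + intros z Hz. destruct (extends_min _ T n z E) as [-> ->]; simpl; [lia|].
      apply place_spec; [apply G|assumption|lia].
Qed.

Definition isolated (n : nat) (R : relation nat) : Prop :=
  forall z, n < z -> incomparable R n z.

Definition isolable (p : condition) (X : relation nat -> Prop) : Prop :=
  exists R, antichain_order R /\ extends p R /\ isolated (level p) R /\ X R.

Lemma refine_forcing_open p (X : relation nat -> Prop) P Q :
  open_pred X -> isolable p X -> ~ (P /\ Q) ->
  exists q m, refines p q /\ level p < m /\
    forces q (fun T => X T /\
      forall z, m <= z -> (T (level p) z <-> P) /\ (T z (level p) <-> Q)).
Proof.
  intros OX (R & G & E & Iso & HX) PQ. destruct (OX R HX) as [k Hk].
  set (m := S (level p) + k).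
  destruct (refine_placing p R m P Q) as (q & Hq & F); try assumption.
  - unfold m. lia.
  - intros z Hz _. apply Iso, Hz.
  - exists q, m. split; [exact Hq|]. split; [unfold m; lia|].
    intros T GT ET. destruct (F T GT ET) as [A HT]. split; [|exact HT].
    apply Hk, (agree_le _ m); [unfold m; lia|exact A].
Qed.

Lemma refine_isolating p : exists q, refines p q /\ forces q (isolated (level p)).
Proof.
  destruct (refine_placing p (approx p) (S (level p)) False False) as (q & Hq & F);
    [apply approx_antichain_order|apply extends_approx|lia|lia|tauto|].
  exists q. split; [exact Hq|]. intros T G E z Hz.
  destruct (F T G E) as [_ H]. destruct (H z Hz). split; tauto.
Qed.

(* [A x] and [B x] are to say that [x] is in some set, resp. in its complement. *)
Definition settled (A B : nat -> relation nat -> Prop) (R : relation nat) : Prop :=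
  exists x N, x < N /\
    ((A x R /\ forall z, N <= z -> R z x) \/
     (B x R /\ forall z, N <= z -> R x z) \/
     (~ A x R /\ ~ B x R)).

Lemma settled_dense (A B : nat -> relation nat -> Prop) p :
  (forall x, open_pred (A x)) -> (forall x, open_pred (B x)) ->
  exists q, refines p q /\ forces q (settled A B).
Proof.
  intros OA OB. set (n := level p).
  destruct (classic (isolable p (A n))) as [HA|HA];
    [|destruct (classic (isolable p (B n))) as [HB|HB]].
  - destruct (refine_forcing_open p (A n) False True) as (q & m & Hq & Hm & F);
      [auto|exact HA|tauto|].
    exists q. split; [exact Hq|]. intros T G E. destruct (F T G E) as [HT Hz].
    exists n, m. split; [exact Hm|]. left.
    split; [exact HT|]. intros z L. apply Hz; auto.
  - destruct (refine_forcing_open p (B n) True False) as (q & m & Hq & Hm & F);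
      [auto|exact HB|tauto|].
    exists q. split; [exact Hq|]. intros T G E. destruct (F T G E) as [HT Hz].
    exists n, m. split; [exact Hm|]. right; left.
    split; [exact HT|]. intros z L. apply Hz; auto.
  - destruct (refine_isolating p) as (q & Hq & F).
    exists q. split; [exact Hq|]. intros T G E.
    exists n, (S n). split; [lia|]. right; right.
    assert (Ep : extends p T)
      by (apply (extends_trans p q); [apply Nat.lt_le_incl, Hq|apply Hq|exact E]).
    split; intros HT; [apply HA|apply HB]; exists T; auto.
Qed.

Section GenericSequence.

Variable Q : nat -> relation nat -> Prop.
Hypothesis Q_dense : forall e p, exists q, refines p q /\ forces q (Q e).

Fixpoint chain (e : nat) : condition :=
  match e with
  | 0 => epsilon condition_inhabited (fun _ => True)
  | S d => epsilon condition_inhabited (fun q => refines (chain d) q /\ forces q (Q d))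
  end.

Lemma chain_succ e : refines (chain e) (chain (S e)) /\ forces (chain (S e)) (Q e).
Proof. exact (epsilon_spec condition_inhabited _ (Q_dense e (chain e))). Qed.

Lemma level_chain e : e <= level (chain e).
Proof. induction e as [|e IH]; [lia|]. destruct (chain_succ e) as [[L _] _]. lia. Qed.

Lemma chain_extends d e :
  d <= e -> level (chain d) <= level (chain e) /\ extends (chain d) (approx (chain e)).
Proof.
  induction 1 as [|e _ [L E]]; [split; [lia|apply extends_approx]|].
  destruct (chain_succ e) as [[L' E'] _].
  split; [lia|]. exact (extends_trans _ _ _ L E E').
Qed.

Definition chain_limit : relation nat := fun a b => approx (chain (max a b)) a b.

Lemma chain_limit_iff e a b :
  a < e -> b < e -> (chain_limit a b <-> approx (chain e) a b).
Proof.
  intros Ha Hb. assert (L := level_chain (max a b)).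
  apply (chain_extends (max a b) e); lia.
Qed.

Lemma chain_limit_antichain_order : antichain_order chain_limit.
Proof.
  assert (G : forall e, antichain_order (approx (chain e)))
    by (intros; apply approx_antichain_order).
  split; [split|].
  - intros x. apply (G (max x x)).
  - intros x y z. set (e := S (x + y + z)).
    rewrite !(chain_limit_iff e) by lia. apply (G e).
  - intros x y. set (e := S (x + y)).
    rewrite !(chain_limit_iff e) by lia. apply (G e).
  - intros x y. apply (G (max x y)).
Qed.

Lemma chain_limit_extends d : extends (chain d) chain_limit.
Proof.
  split.
  - intros a b Ha Hb. set (e := S (a + b + d)).
    rewrite (chain_limit_iff e) by lia. apply (chain_extends d e); lia.
  - intros a z Ha Hz. set (e := S (z + d)).
    rewrite !(chain_limit_iff e) by lia. apply (chain_extends d e); lia.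
Qed.

Lemma generic_order_exists : exists R, antichain_order R /\ forall e, Q e R.
Proof.
  exists chain_limit. split; [apply chain_limit_antichain_order|]. intros e.
  apply chain_succ; [apply chain_limit_antichain_order|apply chain_limit_extends].
Qed.

End GenericSequence.

Lemma settled_order_exists (A B : nat -> nat -> relation nat -> Prop) :
  (forall e x, open_pred (A e x)) -> (forall e x, open_pred (B e x)) ->
  exists R, antichain_order R /\ forall e, settled (A e) (B e) R.
Proof.
  intros OA OB. apply (generic_order_exists (fun e => settled (A e) (B e))).
  intros e p. apply settled_dense; auto.
Qed.

End Forcing.

(** * Omega-models *)

Fixpoint teval (v : nat -> nat) (t : term) : nat :=
  match t with
  | Var n => v n
  | Zero => 0
  | One => 1
  | TAdd a b => teval v a + teval v b
  | TMul a b => teval v a * teval v b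
  end.

Lemma teval_subst v s t : teval v (tsubst s t) = teval (fun n => teval v (s n)) t.
Proof. induction t; simpl; congruence. Qed.

Lemma teval_shift y v t : teval (scons y v) (tshift t) = teval v t.
Proof. apply teval_subst. Qed.

Lemma teval_scons v t s :
  (fun n => teval v (scons t s n)) = scons (teval v t) (fun n => teval v (s n)).
Proof. apply functional_extensionality; intros [|n]; reflexivity. Qed.

Lemma teval_nup y v s :
  (fun n => teval (scons y v) (nup s n)) = scons y (fun n => teval v (s n)).
Proof.
  apply functional_extensionality; intros [|n]; [reflexivity|apply teval_shift].
Qed.

Lemma scons_sup {A : Type} (x : A) (w : nat -> A) (r : nat -> nat) :
  (fun n => scons x w (sup r n)) = scons x (fun n => w (r n)).
Proof. apply functional_extensionality; intros [|n]; reflexivity. Qed.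

Section Semantics.

Variable M : (nat -> Prop) -> Prop.

Fixpoint sat (v : nat -> nat) (w : nat -> nat -> Prop) (f : form) : Prop :=
  match f with
  | Eq a b => teval v a = teval v b
  | Lt a b => teval v a < teval v b
  | Mem a X => w X (teval v a)
  | Bot => False
  | Imp f g => sat v w f -> sat v w g
  | And f g => sat v w f /\ sat v w g
  | Or f g => sat v w f \/ sat v w g
  | NAll f => forall y, sat (scons y v) w f
  | NEx f => exists y, sat (scons y v) w f
  | SAll f => forall X, M X -> sat v (scons X w) f
  | SEx f => exists X, M X /\ sat v (scons X w) f
  end.

Definition in_model (w : nat -> nat -> Prop) : Prop := forall X, M (w X).

Definition valid (f : form) : Prop := forall v w, in_model w -> sat v w f.

Lemma sat_subst f : forall v w s r,
  sat v w (fsubst s r f) <-> sat (fun n => teval v (s n)) (fun X => w (r X)) f.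
Proof.
  induction f as
    [a b|a b|a X| |f IHf g IHg|f IHf g IHg|f IHf g IHg|f IHf|f IHf|f IHf|f IHf];
    intros v w s r; simpl; rewrite ?teval_subst, ?IHf, ?IHg; try reflexivity.
  - split; intros H y; specialize (H y); rewrite IHf, teval_nup in *; exact H.
  - split; intros [y H]; exists y; rewrite IHf, teval_nup in *; exact H.
  - split; intros H X HX; specialize (H X HX); rewrite IHf, scons_sup in *; exact H.
  - split; intros (X & HX & H); exists X; rewrite IHf, scons_sup in *; auto.
Qed.

Lemma sat_ninst v w t f : sat v w (ninst t f) <-> sat (scons (teval v t) v) w f.
Proof. unfold ninst. rewrite sat_subst, teval_scons. reflexivity. Qed.

Lemma sat_nshift y v w f : sat (scons y v) w (nshift f) <-> sat v w f.
Proof. exact (sat_subst f (scons y v) w _ _). Qed.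

Lemma sat_sinst v w X f : sat v w (sinst X f) <-> sat v (scons (w X) w) f.
Proof.
  unfold sinst. rewrite sat_subst.
  replace (fun Y => w (scons X (fun Z => Z) Y)) with (scons (w X) w); [reflexivity|].
  apply functional_extensionality; intros [|Y]; reflexivity.
Qed.

Lemma sat_sshift X v w f : sat v (scons X w) (sshift f) <-> sat v w f.
Proof. exact (sat_subst f v (scons X w) _ _). Qed.

Lemma in_model_scons X w : M X -> in_model w -> in_model (scons X w).
Proof. intros HX Hw [|Y]; [exact HX|apply Hw]. Qed.

Lemma Forall_sat_nshift y v w G :
  Forall (sat v w) G -> Forall (sat (scons y v) w) (map nshift G).
Proof. rewrite Forall_map. apply Forall_impl. intros f. apply sat_nshift. Qed.

Lemma Forall_sat_sshift X v w G :
  Forall (sat v w) G -> Forall (sat v (scons X w)) (map sshift G).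
Proof. rewrite Forall_map. apply Forall_impl. intros f. apply sat_sshift. Qed.

Lemma prv_sound G f :
  prv G f -> forall v w, in_model w -> Forall (sat v w) G -> sat v w f.
Proof.
  induction 1 as
    [G f Hf|G f g _ IH|G f g _ IH1 _ IH2|G f g _ IH1 _ IH2|G f g _ IH|G f g _ IH
    |G f g _ IH|G f g _ IH|G f g h _ IH1 _ IH2 _ IH3|G f _ IH|G f _ IH|G f t _ IH
    |G f t _ IH|G f g _ IH1 _ IH2|G f _ IH|G f X _ IH|G f X _ IH|G f g _ IH1 _ IH2
    |G t|G s t f _ IH1 _ IH2]; intros v w Hw HG; simpl sat in *.
  - exact (proj1 (Forall_forall _ _) HG f Hf).
  - intros Hf. apply IH; auto.
  - apply IH1; auto.
  - auto.
  - apply (IH v w Hw HG).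
  - apply (IH v w Hw HG).
  - auto.
  - auto.
  - destruct (IH1 v w Hw HG); [apply IH2|apply IH3]; auto.
  - apply NNPP. intros Hn. apply (IH v w Hw). auto.
  - intros y. apply IH; [exact Hw|]. apply Forall_sat_nshift, HG.
  - apply sat_ninst. apply (IH v w Hw HG).
  - exists (teval v t). apply sat_ninst. auto.
  - destruct (IH1 v w Hw HG) as [y Hy]. apply (sat_nshift y).
    apply IH2; [exact Hw|]. apply Forall_cons; [exact Hy|]. apply Forall_sat_nshift, HG.
  - intros X HX. apply IH; [apply in_model_scons; assumption|].
    apply Forall_sat_sshift, HG.
  - apply sat_sinst. apply (IH v w Hw HG). apply Hw.
  - exists (w X). split; [apply Hw|]. apply sat_sinst. auto.
  - destruct (IH1 v w Hw HG) as (X & HX & H). apply (sat_sshift X).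
    apply IH2; [apply in_model_scons; assumption|].
    apply Forall_cons; [exact H|]. apply Forall_sat_sshift, HG.
  - reflexivity.
  - apply sat_ninst. rewrite <- (IH1 v w Hw HG). apply sat_ninst. auto.
Qed.

Lemma proves_valid (T : form -> Prop) f :
  (forall a, T a -> valid a) -> proves T f -> valid f.
Proof.
  intros HT (G & HG & H) v w Hw. apply (prv_sound G f H v w Hw).
  apply Forall_forall. intros a Ha. apply HT; auto.
Qed.

Lemma closure_valid f : valid f -> valid (closure f).
Proof.
  intros Hf. unfold closure.
  induction (sbound f) as [|n IH]; simpl.
  - induction (nbound f) as [|n IH]; simpl; [exact Hf|]. intros v w Hw y. apply IH, Hw.
  - intros v w Hw X HX. apply IH, in_model_scons; assumption.
Qed.

Lemma basic_axioms_valid f : In f basic_axioms -> valid f.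
Proof. intros Hf v w _. repeat (destruct Hf as [<-|Hf]; [simpl; lia|]). destruct Hf. Qed.

Lemma induction_valid f : valid (induction f).
Proof.
  intros v w _ [H0 HS] y. apply sat_ninst in H0. induction y as [|y IH]; [exact H0|].
  specialize (HS y IH). apply sat_subst in HS.
  rewrite teval_scons in HS. simpl in HS. rewrite Nat.add_1_r in HS. exact HS.
Qed.

End Semantics.

(** * Sets Delta_1 in an oracle *)

(* Implication occurs only in bounded quantifiers and to negate membership atoms,
   so that the truth of such a formula depends on a finite part of the oracle. *)
Inductive sigma_form : form -> Prop :=
| sigma_Eq s t : sigma_form (Eq s t)
| sigma_Lt s t : sigma_form (Lt s t)
| sigma_Mem t X : sigma_form (Mem t X)
| sigma_NotMem t X : sigma_form (Imp (Mem t X) Bot)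
| sigma_And f g : sigma_form f -> sigma_form g -> sigma_form (And f g)
| sigma_Or f g : sigma_form f -> sigma_form g -> sigma_form (Or f g)
| sigma_Ball t f : sigma_form f -> sigma_form (ball t f)
| sigma_NEx f : sigma_form f -> sigma_form (NEx f).

(* Every set variable denotes the oracle; the model is irrelevant, as
   [holds] is only applied to formulas without set quantifiers. *)
Definition holds (O : nat -> Prop) (v : nat -> nat) (f : form) : Prop :=
  sat (fun _ => False) v (fun _ => O) f.

Lemma tsubst_nup_tshift s t : tsubst (nup s) (tshift t) = tshift (tsubst s t).
Proof. induction t; simpl; unfold tshift in *; simpl; congruence. Qed.

Lemma sigma_form_subst f : sigma_form f -> forall s r, sigma_form (fsubst s r f).
Proof.
  induction 1 as [| | | | | |t f _ IH|]; intros e r; try (constructor; auto; fail).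
  simpl. rewrite tsubst_nup_tshift. apply sigma_Ball, IH.
Qed.

Lemma bounded_collection (P : nat -> nat -> Prop) k :
  (forall y m m', m <= m' -> P y m -> P y m') ->
  (forall y, y < k -> exists m, P y m) -> exists m, forall y, y < k -> P y m.
Proof.
  intros mono. induction k as [|k IH]; intros H.
  - exists 0. lia.
  - destruct IH as [m Hm]; [auto|]. destruct (H k) as [m' Hm']; [lia|].
    exists (max m m'). intros y Hy. destruct (Nat.eq_dec y k) as [->|].
    + apply (mono k m'); [lia|exact Hm'].
    + apply (mono y m); [lia|]. apply Hm. lia.
Qed.

Definition secures (O : nat -> Prop) (v : nat -> nat) (f : form) (m : nat) : Prop :=
  forall O', (forall k, k < m -> (O k <-> O' k)) -> holds O' v f.

Lemma secures_le O v f m m' : m <= m' -> secures O v f m -> secures O v f m'.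
Proof. intros L H O' E. apply H. intros k Hk. apply E. lia. Qed.

Lemma sigma_form_secured O f :
  sigma_form f -> forall v, holds O v f -> exists m, secures O v f m.
Proof.
  induction 1 as [s t|s t|t X|t X|f g _ IHf _ IHg|f g _ IHf _ IHg|t f _ IH|f _ IH];
    intros v H.
  - exists 0. intros O' _. exact H.
  - exists 0. intros O' _. exact H.
  - exists (S (teval v t)). intros O' E. apply E; [lia|exact H].
  - exists (S (teval v t)). intros O' E H'. apply H, E; [lia|exact H'].
  - destruct H as [Hf Hg]. destruct (IHf v Hf) as [m Hm], (IHg v Hg) as [m' Hm'].
    exists (max m m'). intros O' E.
    split; [apply Hm|apply Hm']; intros k Hk; apply E; lia.
  - destruct H as [H|H]; [destruct (IHf v H) as [m Hm]|destruct (IHg v H) as [m Hm]];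
      exists m; intros O' E; [left|right]; apply Hm, E.
  - destruct (bounded_collection (fun y => secures O (scons y v) f) (teval v t))
      as [m Hm].
    + intros y. apply secures_le.
    + intros y Hy. apply IH, H. simpl. rewrite teval_shift. exact Hy.
    + exists m. intros O' E y Hy. simpl in Hy. rewrite teval_shift in Hy.
      apply (Hm y Hy), E.
  - destruct H as [y H]. destruct (IH _ H) as [m Hm].
    exists m. intros O' E. exists y. apply Hm, E.
Qed.

Fixpoint numeral (n : nat) : term :=
  match n with 0 => Zero | S n => TAdd (numeral n) One end.

Lemma teval_numeral v n : teval v (numeral n) = n.
Proof. induction n; simpl; lia. Qed.

Section Delta.

Variable O : nat -> Prop.

Definition definable (A : (nat -> nat) -> Prop) : Prop :=
  exists f, sigma_form f /\ forall v, A v <-> holds O v f.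

Definition delta1 (A : (nat -> nat) -> Prop) : Prop :=
  definable A /\ definable (fun v => ~ A v).

Definition delta (X : nat -> Prop) : Prop := delta1 (fun v => X (v 0)).

Lemma definable_iff A B : (forall v, A v <-> B v) -> definable A -> definable B.
Proof.
  intros E (f & Sf & Hf). exists f. split; [exact Sf|]. intros v. rewrite <- E. apply Hf.
Qed.

Lemma definable_eq s t : definable (fun v => teval v s = teval v t).
Proof. exists (Eq s t). split; [constructor|reflexivity]. Qed.

Lemma definable_lt s t : definable (fun v => teval v s < teval v t).
Proof. exists (Lt s t). split; [constructor|reflexivity]. Qed.

Lemma definable_and A B : definable A -> definable B -> definable (fun v => A v /\ B v).
Proof.
  intros (f & Sf & Hf) (g & Sg & Hg). exists (And f g). split; [constructor; assumption|].
  intros v. rewrite Hf, Hg. reflexivity.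
Qed.

Lemma definable_or A B : definable A -> definable B -> definable (fun v => A v \/ B v).
Proof.
  intros (f & Sf & Hf) (g & Sg & Hg). exists (Or f g). split; [constructor; assumption|].
  intros v. rewrite Hf, Hg. reflexivity.
Qed.

Lemma definable_ball t A :
  definable A -> definable (fun v => forall y, y < teval v t -> A (scons y v)).
Proof.
  intros (f & Sf & Hf). exists (ball t f). split; [constructor; assumption|].
  intros v. unfold holds. simpl. setoid_rewrite teval_shift.
  split; intros H y Hy; apply Hf, H, Hy.
Qed.

Lemma definable_ex A : definable A -> definable (fun v => exists y, A (scons y v)).
Proof.
  intros (f & Sf & Hf). exists (NEx f). split; [constructor; assumption|].
  intros v. split; intros [y H]; exists y; apply Hf, H.
Qed.

Lemma definable_bex t A :
  definable A -> definable (fun v => exists y, y < teval v t /\ A (scons y v)).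
Proof.
  intros HA.
  apply (definable_iff (fun v =>
    exists y, teval (scons y v) (Var 0) < teval (scons y v) (tshift t) /\ A (scons y v))).
  - intros v. setoid_rewrite teval_shift. reflexivity.
  - apply (definable_ex (fun v => teval v (Var 0) < teval v (tshift t) /\ A v)).
    apply definable_and; [apply definable_lt|exact HA].
Qed.

Lemma definable_subst A s :
  definable A -> definable (fun v => A (fun n => teval v (s n))).
Proof.
  intros (f & Sf & Hf). exists (fsubst s (fun X => X) f).
  split; [apply sigma_form_subst, Sf|].
  intros v. unfold holds. rewrite sat_subst. apply Hf.
Qed.

Lemma definable_parameters A w : definable A -> definable (fun v => A (scons (v 0) w)).
Proof.
  intros HA.
  set (s := scons (Var 0) (fun n => numeral (w n))).
  apply (definable_iff (fun v => A (fun n => teval v (s n)))).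
  - unfold s. intros v. rewrite teval_scons.
    replace (fun n => teval v (numeral (w n))) with w; [reflexivity|].
    apply functional_extensionality. intros n. symmetry. apply teval_numeral.
  - apply definable_subst, HA.
Qed.

Lemma delta1_iff A B : (forall v, A v <-> B v) -> delta1 A -> delta1 B.
Proof.
  intros E [HA HA']. split; [exact (definable_iff A B E HA)|].
  apply (definable_iff (fun v => ~ A v)); [|exact HA']. intros v. rewrite E. reflexivity.
Qed.

Lemma delta1_eq s t : delta1 (fun v => teval v s = teval v t).
Proof.
  split; [apply definable_eq|].
  apply (definable_iff (fun v => teval v s < teval v t \/ teval v t < teval v s)).
  - lia.
  - apply definable_or; apply definable_lt.
Qed.

Lemma delta1_lt s t : delta1 (fun v => teval v s < teval v t).
Proof.
  split; [apply definable_lt|].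
  apply (definable_iff (fun v => teval v t < teval v s \/ teval v s = teval v t)).
  - lia.
  - apply definable_or; [apply definable_lt|apply definable_eq].
Qed.

Lemma delta1_not A : delta1 A -> delta1 (fun v => ~ A v).
Proof.
  intros [HA HA']. split; [exact HA'|]. apply (definable_iff A); [|exact HA].
  intros v. tauto.
Qed.

Lemma delta1_and A B : delta1 A -> delta1 B -> delta1 (fun v => A v /\ B v).
Proof.
  intros [HA HA'] [HB HB']. split; [apply definable_and; assumption|].
  apply (definable_iff (fun v => ~ A v \/ ~ B v)).
  - intros v. tauto.
  - apply definable_or; assumption.
Qed.

Lemma delta1_bex t A :
  delta1 A -> delta1 (fun v => exists y, y < teval v t /\ A (scons y v)).
Proof.
  intros [HA HA']. split; [apply definable_bex, HA|].
  apply (definable_iff (fun v => forall y, y < teval v t -> ~ A (scons y v))).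
  - intros v. firstorder.
  - apply (definable_ball t (fun v => ~ A v)), HA'.
Qed.

Lemma delta1_subst A s : delta1 A -> delta1 (fun v => A (fun n => teval v (s n))).
Proof.
  intros [HA HA']. split; [exact (definable_subst A s HA)|].
  exact (definable_subst (fun v => ~ A v) s HA').
Qed.

Lemma delta1_parameters A w : delta1 A -> delta (fun n => A (scons n w)).
Proof.
  intros [HA HA']. split; [exact (definable_parameters A w HA)|].
  exact (definable_parameters (fun v => ~ A v) w HA').
Qed.

Lemma bounded_delta1 M f w :
  bounded f -> in_model delta w -> delta1 (fun v => sat M v w f).
Proof.
  intros Hf Hw.
  induction Hf as
    [s t|s t|t X| |f g _ F _ G|f g _ F _ G|f g _ F _ G|t f _ F|t f _ F]; simpl.
  - apply delta1_eq.
  - apply delta1_lt.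
  - apply (delta1_subst (fun v => w X (v 0)) (fun _ => t)), Hw.
  - apply (delta1_iff (fun v => teval v Zero < teval v Zero)); [simpl; lia|].
    apply delta1_lt.
  - apply (delta1_iff (fun v => ~ (sat M v w f /\ ~ sat M v w g))); [intros v; tauto|].
    auto using delta1_not, delta1_and.
  - apply delta1_and; assumption.
  - apply (delta1_iff (fun v => ~ (~ sat M v w f /\ ~ sat M v w g))); [intros v; tauto|].
    auto using delta1_not, delta1_and.
  - apply (delta1_iff (fun v => ~ exists y, y < teval v t /\ ~ sat M (scons y v) w f)).
    + intros v. setoid_rewrite teval_shift. split.
      * intros H y Hy. apply NNPP. intros N. apply H. eauto.
      * intros H (y & Hy & N). auto.
    + apply delta1_not, (delta1_bex t (fun v => ~ sat M v w f)), delta1_not, F.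
  - apply (delta1_iff (fun v => exists y, y < teval v t /\ sat M (scons y v) w f)).
    + intros v. setoid_rewrite teval_shift. reflexivity.
    + apply (delta1_bex t (fun v => sat M v w f)), F.
Qed.

Lemma bounded_delta M f v w :
  bounded f -> in_model delta w -> delta (fun n => sat M (scons n v) w f).
Proof.
  intros Hf Hw. apply (delta1_parameters (fun u => sat M u w f)).
  apply bounded_delta1; assumption.
Qed.

Lemma delta_comprehension_valid f g :
  Sigma01 f -> Pi01 g -> valid delta (delta_comprehension f g).
Proof.
  intros [f' Hf] [g' Hg] v w Hw E.
  set (X n := exists y, sat delta (scons y (scons n v)) w f').
  assert (Sigma_X : definable (fun u => X (u 0))).
  { apply (definable_parameters (fun u => exists y, sat delta (scons y u) w f') v).
    apply (definable_ex (fun u => sat delta u w f')), bounded_delta1; assumption. }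
  assert (Sigma_not_X : definable (fun u => ~ X (u 0))).
  { apply (definable_iff (fun u => exists y, ~ sat delta (scons y (scons (u 0) v)) w g')).
    - intros u. split.
      + intros [y Hy] H. apply Hy, (proj1 (E (u 0)) H).
      + intros H. apply not_all_ex_not. intros K. exact (H (proj2 (E (u 0)) K)).
    - apply (definable_parameters (fun u => exists y, ~ sat delta (scons y u) w g') v).
      apply (definable_ex (fun u => ~ sat delta u w g')), bounded_delta1; assumption. }
  exists X. split; [split; assumption|]. intros n. split; intros H.
  - apply sat_sshift. exact H.
  - apply sat_sshift in H. exact H.
Qed.

Lemma RCA0_valid f : RCA0 f -> valid delta f.
Proof.
  intros [g Hg|g _|g h Hg Hh]; apply closure_valid.
  - apply basic_axioms_valid, Hg.
  - apply induction_valid.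
  - apply delta_comprehension_valid; assumption.
Qed.

Lemma delta_oracle : delta O.
Proof.
  split; [exists (Mem (Var 0) 0)|exists (Imp (Mem (Var 0) 0) Bot)];
    (split; [constructor|reflexivity]).
Qed.

End Delta.

Definition tagged_code (tag k l : nat) : nat := to_nat (tag, to_nat (k, l)).

Lemma tagged_code_inj t k l t' k' l' :
  tagged_code t k l = tagged_code t' k' l' -> t = t' /\ k = k' /\ l = l'.
Proof.
  unfold tagged_code. intros E.
  apply to_nat_inj, pair_equal_spec in E. destruct E as [-> E].
  apply to_nat_inj, pair_equal_spec in E. tauto.
Qed.

Fixpoint term_code (t : term) : nat :=
  match t with
  | Var n => tagged_code 0 n 0
  | Zero => tagged_code 1 0 0
  | One => tagged_code 2 0 0
  | TAdd a b => tagged_code 3 (term_code a) (term_code b)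
  | TMul a b => tagged_code 4 (term_code a) (term_code b)
  end.

Fixpoint form_code (f : form) : nat :=
  match f with
  | Eq a b => tagged_code 0 (term_code a) (term_code b)
  | Lt a b => tagged_code 1 (term_code a) (term_code b)
  | Mem a X => tagged_code 2 (term_code a) X
  | Bot => tagged_code 3 0 0
  | Imp f g => tagged_code 4 (form_code f) (form_code g)
  | And f g => tagged_code 5 (form_code f) (form_code g)
  | Or f g => tagged_code 6 (form_code f) (form_code g)
  | NAll f => tagged_code 7 (form_code f) 0
  | NEx f => tagged_code 8 (form_code f) 0
  | SAll f => tagged_code 9 (form_code f) 0
  | SEx f => tagged_code 10 (form_code f) 0
  end.

Lemma term_code_inj s : forall t, term_code s = term_code t -> s = t.
Proof.
  induction s; intros [] E; apply tagged_code_inj in E; destruct E as (Et & Ek & El);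
    try discriminate Et; f_equal; auto.
Qed.

Lemma form_code_inj f : forall g, form_code f = form_code g -> f = g.
Proof.
  induction f; intros [] E; apply tagged_code_inj in E; destruct E as (Et & Ek & El);
    try discriminate Et; f_equal; auto using term_code_inj.
Qed.

Definition nth_form (n : nat) : form :=
  epsilon (inhabits Bot) (fun f => form_code f = n).

Lemma nth_form_code f : nth_form (form_code f) = f.
Proof.
  apply form_code_inj.
  apply (epsilon_spec (inhabits Bot) (fun g => form_code g = form_code f)). eauto.
Qed.

(** * The counterexample *)

Definition pair_code (x y : nat) : nat := (x + y) * (x + y) + x.

Lemma pair_code_inj x y x' y' : pair_code x y = pair_code x' y' -> x = x' /\ y = y'.
Proof.
  unfold pair_code. intros E.
  assert (x + y = x' + y'); [|nia].
  destruct (Nat.lt_trichotomy (x + y) (x' + y')) as [L|[L|L]]; [nia|exact L|nia].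
Qed.

Lemma pair_code_ge x y : x <= pair_code x y /\ y <= pair_code x y.
Proof. unfold pair_code. split; nia. Qed.

Definition graph (R : relation nat) (k : nat) : Prop :=
  exists x y, k = pair_code x y /\ R x y.

Lemma graph_pair R x y : graph R (pair_code x y) <-> R x y.
Proof.
  split.
  - intros (x' & y' & E & H). apply pair_code_inj in E. destruct E as [-> ->]. exact H.
  - intros H. exists x, y. auto.
Qed.

Lemma graph_agree m R T : agree m R T -> forall k, k < m -> (graph R k <-> graph T k).
Proof.
  intros A k Hk. split; intros (x & y & -> & H); exists x, y; (split; [reflexivity|]);
    destruct (pair_code_ge x y); apply (A x y); (assumption || lia).
Qed.

Lemma sigma_form_open f v :
  open_pred (fun R => sigma_form f /\ holds (graph R) v f).
Proof.
  intros R [Sf H]. destruct (sigma_form_secured _ f Sf v H) as [m Hm].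
  exists m. intros T A. split; [exact Sf|]. apply Hm, graph_agree, A.
Qed.

Definition almost_bounded (R : relation nat) (I : nat -> Prop) : Prop :=
  exists x N, x < N /\
    ((I x /\ forall z, N <= z -> R z x) \/ (~ I x /\ forall z, N <= z -> R x z)).

Lemma generic_delta_order_exists (D : nat -> Prop) :
  unbounded D -> unbounded (fun n => ~ D n) ->
  exists R, antichain_order D R /\
    forall I, delta (graph R) I -> almost_bounded R I.
Proof.
  intros HD HcD.
  set (A f x R := sigma_form f /\ holds (graph R) (fun _ => x) f).
  destruct (settled_order_exists D HD HcD
    (fun e => A (nth_form (fst (of_nat e)))) (fun e => A (nth_form (snd (of_nat e)))))
    as (R & G & H); [intros; apply sigma_form_open|intros; apply sigma_form_open|].
  exists R. split; [exact G|]. intros I [(f & Sf & Hf) (g & Sg & Hg)].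
  specialize (H (to_nat (form_code f, form_code g))).
  rewrite cancel_of_to in H. simpl in H. rewrite !nth_form_code in H.
  assert (Af : forall x, A f x R <-> I x)
    by (intros x; rewrite (Hf (fun _ => x)); unfold A; tauto).
  assert (Ag : forall x, A g x R <-> ~ I x)
    by (intros x; rewrite (Hg (fun _ => x)); unfold A; tauto).
  destruct H as (x & N & L & H). exists x, N. split; [exact L|].
  rewrite Af, Ag in H. tauto.
Qed.

Lemma initial_interval_union R (I : nat -> Prop) :
  order nat R -> (forall a b, R a b -> I b -> I a) -> almost_bounded R I ->
  exists N, forall y, I y <-> exists i, i < N /\ I i /\ R y i.
Proof.
  intros G down (x & N & L & H). exists N. intros y. split.
  - intros Hy. destruct (le_lt_dec N y) as [Ny|Ny].
    + destruct H as [[Hx H]|[Hx H]]; [exists x; auto|].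
      destruct Hx. exact (down _ _ (H y Ny) Hy).
    + exists y. repeat split; auto. apply (ord_refl _ _ G).
  - intros (i & _ & Hi & HR). exact (down _ _ HR Hi).
Qed.

(* The [i]-th section is the principal ideal of [i] if [i] is in [I], and is
   empty otherwise. *)
Definition ideal_sequence (R : relation nat) (I : nat -> Prop) (N : nat) : nat -> Prop :=
  graph (fun y i => i < N /\ I i /\ R y i).

Lemma delta_ideal_sequence R I N :
  delta (graph R) I -> delta (graph R) (ideal_sequence R I N).
Proof.
  intros DI.
  set (f := bex (#0 + One) (bex (#1 + One)
    (#2 == code #1 #0 /\ #0 < #3 /\ #0 IN 0 /\ #2 IN 1))%L2).
  set (w := scons I (fun _ => graph R)).
  assert (Hw : in_model (delta (graph R)) w)
    by (apply in_model_scons; [exact DI|intros X; apply delta_oracle]).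
  assert (Df := bounded_delta (graph R) (delta (graph R)) f (fun _ => N) w
    ltac:(repeat constructor) Hw).
  refine (delta1_iff _ _ _ _ Df). intros v. unfold f. simpl. split.
  - intros (y & _ & i & _ & E & Hi & HI & HR). rewrite E in HR.
    apply graph_pair in HR. exists y, i. auto.
  - intros (y & i & E & Hi & HI & HR). destruct (pair_code_ge y i).
    exists y. split; [lia|]. exists i. split; [lia|]. repeat split; auto.
    rewrite E. apply graph_pair, HR.
Qed.

Lemma delta_section O Z i : delta O Z -> delta O (fun y => Z (pair_code y i)).
Proof.
  intros DZ.
  apply (bounded_delta O (delta O) (code #0 #1 IN 0)%L2 (fun _ => i) (fun _ => Z));
    [constructor|intros X; exact DZ].
Qed.

Lemma delta_univ O : delta O (fun _ => True).
Proof.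
  apply (delta1_iff O (fun v => teval v Zero = teval v Zero)); [simpl; tauto|].
  apply delta1_eq.
Qed.

Lemma delta_even O : delta O Nat.Even.
Proof.
  apply (delta1_iff O (fun v => exists y, y < teval v (#0 + One)%L2 /\
    teval (scons y v) (#1)%L2 = teval (scons y v) (#0 + #0)%L2)).
  - intros v. simpl. split.
    + intros (y & _ & E). exists y. lia.
    + intros [y E]. exists y. lia.
  - apply (delta1_bex O _ (fun v => teval v (#1)%L2 = teval v (#0 + #0)%L2)), delta1_eq.
Qed.

Section Satisfaction.

Variable M : (nat -> Prop) -> Prop.
Variable R : relation nat.
Hypothesis R_order : order nat R.

Variables (v : nat -> nat) (w : nat -> nat -> Prop) (P r : nat).
Hypothesis P_full : forall n, w P n.
Hypothesis r_graph : w r = graph R.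

Lemma sat_partial_order : sat M v w (partial_order P r).
Proof.
  destruct R_order as [rfl trans asym]. simpl. rewrite r_graph.
  split; [|split; [|split]].
  - intros k (x & y & -> & _). exists x, y. auto.
  - intros x _. apply graph_pair, rfl.
  - intros x y H K. apply graph_pair in H, K. auto.
  - intros x y z H K. apply graph_pair in H, K. apply graph_pair. eauto.
Qed.

Lemma sat_principal_ideal A (c : Prop) i :
  (forall y, w A y <-> c /\ R y i) -> sat M v w (ideal P r A).
Proof.
  destruct R_order as [rfl trans _]. intros HA. simpl. rewrite r_graph.
  split; [split|].
  - auto.
  - intros a b Hab Hb. apply graph_pair in Hab. apply HA in Hb. apply HA.
    split; [tauto|]. apply (trans _ b); tauto.
  - intros a b Ha Hb. apply HA in Ha, Hb. exists i.
    split; [|split]; [apply HA|apply graph_pair|apply graph_pair]; try tauto.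
    split; [tauto|apply rfl].
Qed.

Lemma sat_antichain A :
  (forall a b, w A a -> w A b -> R a b -> a = b) -> sat M v w (antichain P r A).
Proof.
  intros HA. simpl. rewrite r_graph. split; [auto|].
  intros x y Hx Hy N. split; intros H; apply graph_pair in H; apply N; auto.
  symmetry. auto.
Qed.

End Satisfaction.

Lemma sat_finite_union_of_ideals R v w P r A N :
  order nat R -> (forall n, w P n) -> w r = graph R -> delta (graph R) (w A) ->
  (forall y, w A y <-> exists i, i < N /\ w A i /\ R y i) ->
  sat (delta (graph R)) v w (finite_union_of_ideals P r A).
Proof.
  intros G HP Hr DA HA. set (Z := ideal_sequence R (w A) N).
  assert (DZ : delta (graph R) Z) by (apply delta_ideal_sequence, DA).
  assert (HZ : forall y i, Z (pair_code y i) <-> (i < N /\ w A i) /\ R y i).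
  { intros y i. unfold Z, ideal_sequence. rewrite graph_pair. tauto. }
  exists N, Z. split; [exact DZ|]. split.
  - intros i Hi. exists (fun y => Z (pair_code y i)).
    split; [apply delta_section, DZ|]. split; [intros y; simpl; tauto|].
    apply (sat_principal_ideal _ R G) with (c := i < N /\ w A i) (i := i);
      [exact HP|exact Hr|exact (fun y => HZ y i)].
  - intros y. simpl. rewrite (HA y).
    split; intros (i & Hi & H); exists i; (split; [exact Hi|]).
    + apply HZ. tauto.
    + apply HZ in H. tauto.
Qed.

Theorem theorem5p12 :
  ~ proves RCA0 finite_unions_imply_no_infinite_antichain.
Proof.
  intros H.
  destruct (generic_delta_order_exists Nat.Even) as (R & G & HR).
  { intros n. exists (n + n). split; [lia|]. exists n. lia. }
  { intros n. exists (S (n + n)). split; [lia|]. intros [k E]. lia. }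
  set (M := delta (graph R)).
  assert (no_antichain := proves_valid M _ _ (RCA0_valid (graph R)) H
    (fun _ => 0) (fun _ => graph R) (fun _ => delta_oracle (graph R))
    (fun _ => True) (delta_univ _) (graph R) (delta_oracle _)).
  apply no_antichain; [split|exists Nat.Even; split; [apply delta_even|split]].
  - apply (sat_partial_order M R G); simpl; auto.
  - intros I DI [_ down].
    assert (I_down : forall a b, R a b -> I b -> I a)
      by (intros a b Hab; apply (down a b), graph_pair, Hab).
    destruct (initial_interval_union R I G I_down (HR I DI)) as [N HN].
    apply (sat_finite_union_of_ideals R _ _ _ _ _ N G); simpl; auto.
  - apply (sat_antichain M R); simpl; auto. apply (antichain_eq _ _ G).
  - intros n. exists (S n + S n). simpl. split; [lia|]. exists (S n). lia.
Qed.
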